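(* Under randomized reduction, the anonymous failure detector $\mathcal{N}$ is stronger than the anonymous failure detector $\Theta$; that is, $\Theta$ can be reduced to $\mathcal{N}$ by a randomized reduction.
   Context: Model. $P=\{p_1,\dots,p_n\}$ is a set of $n$ processes; the clock ranges over $\mathbb{N}$. A failure pattern is a function $F:\mathbb{N}\to 2^P$, where $F(t)$ is the set of processes crashed at time $t$; processes fail only by crashing (halting permanently). Put $crashed(F)=\bigcup_{t\in\mathbb{N}}F(t)$ and $correct(F)=P\setminus crashed(F)$; at least one process is correct. An environment $\mathcal{E}$ is a set of possible failure patterns. Each process is connected to every other process by a reliable channel, with unbounded but finite message delays. Communication uses a broadcast primitive and an anonymous receive operation, in which the receiver cannot tell who sent the message; formally, if $R_i(j,t)$ is the value process $i$ receives from process $j$ at time $t$, the anonymous receive operation is given by $R_i^{\Pi}(j,t)=R_i(\Pi(j),t)$ for a permutation $\Pi$ of $P$. Failure detectors. A failure detector $\mathcal{D}$ maps each failure pattern $F$ to a set $\mathcal{D}(F)$ of histories $H:P\times\mathbb{N}\to V_{\mathcal{D}}$, where $H(p,t)$ is the output of the module of $p$ at time $t$. For a permutation $\Pi$ of $P$ put $F^{\Pi}(t)=\Pi(F(t))$ and $H^{\Pi}(p,t)=H(\Pi(p),t)$; $\mathcal{D}$ is called anonymous if $H^{\Pi}\in\mathcal{D}(F^{\Pi})$ for all $\Pi$. For $\mathcal{N}$ the range is $\{0,1,\dots,n\}$ (the number of processes suspected to have crashed), and $\mathcal{N}(F)$ is the set of all $H$ satisfying: (Completeness) there is $t\in\mathbb{N}$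 such that $H(q,t')\ge |crashed(F)|$ for all $t'\ge t$ and all $q\in P$; (Accuracy) $H(q,t)\le |crashed(F)|$ for all $t\in\mathbb{N}$ and all $q\in correct(F)$. For $\Theta$ the range is $\{true,false\}$, and $\Theta(F)$ is the set of all $H$ satisfying: (Eventual Self-Trust) there are $t\in\mathbb{N}$ and $p\in correct(F)$ such that for all $t'>t$, $H(p,t')=true$ and $H(q,t')=false$ for all $q\in correct(F)\setminus\{p\}$. Randomized reductions. Under randomized reduction, an anonymous failure detector $\mathcal{D}'$ can be reduced to another failure detector $\mathcal{D}$ (''$\mathcal{D}$ is stronger than $\mathcal{D}'$'') if there is an algorithm $T_{\mathcal{D}\to\mathcal{D}'}$, which may use randomness, that transforms $\mathcal{D}$ to $\mathcal{D}'$ under an environment $\mathcal{E}$: using $\mathcal{D}$, it maintains a variable $output_p$ at every process $p$, which emulates the output of $\mathcal{D}'$ at $p$, and for the history $O$ of all the output variables it is required only that $O^{\Pi}\in\mathcal{D}'(F^{\Pi})$ holds with probability at least $2/3$, where $F\in\mathcal{E}$ and $\Pi$ is a permutation of the processes. No particular environment is singled out in the result.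
   Formalization: The renamed failure pattern F^Π(t) is taken as the preimage {p : Π(p) ∈ F(t)} instead of the direct image Π(F(t)); with the direct image and H^Π(p,t)=H(Π(p),t), Θ is not anonymous and the requirement for all Π is unattainable (e.g. n=5, three processes crashed at time 0). *)

(* Defs.v *)
From HB Require Import structures.
From mathcomp Require Import all_boot all_order all_fingroup all_algebra.
From mathcomp Require Import all_classical all_reals all_analysis.

Set Implicit Arguments.
Unset Strict Implicit.
Unset Printing Implicit Defensive.

Local Open Scope classical_set_scope.

Record failure_pattern (n : nat) := FailurePattern {
  crashed_at :> nat -> {set 'I_n};
  crashed_at_mono : forall s t : nat, (s <= t)%N ->
    crashed_at s \subset crashed_at t;
  crashed_at_correct : exists p, forall t, p \notin crashed_at t }.

Definition crashed n (F : failure_pattern n) : {set 'I_n} :=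
  [set p | `[< exists t, p \in F t >]]%SET.

Definition correct n (F : failure_pattern n) : {set 'I_n} := (~: crashed F)%SET.

Definition environment (n : nat) := set (failure_pattern n).

Definition history (n : nat) (V : Type) := 'I_n -> nat -> V.

(** Renaming by [Pi] means that the process now called [p] is the
    process formerly called [Pi p]. Hence [H^Pi(p,t) = H(Pi(p),t)], and the
    processes crashed in [F^Pi] at time [t] are those [p] with [Pi p] in
    [F t]. Taking the direct image [Pi(F t)] together with [H(Pi(p),t)] would
    rename patterns and histories in opposite directions, and then neither
    detector below would be anonymous for n >= 3. As [Pi] always ranges over all
    permutations, replacing [Pi] by its inverse in both formulas changes
    nothing. *)

Lemma perm_pattern_mono n (Pi : {perm 'I_n}) (F : failure_pattern n) (s t : nat) :
  (s <= t)%N -> (Pi @^-1: F s \subset Pi @^-1: F t)%SET.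
Proof. by move=> st; exact/preimsetS/crashed_at_mono. Qed.

Lemma perm_pattern_correct n (Pi : {perm 'I_n}) (F : failure_pattern n) :
  exists p, forall t, p \notin (Pi @^-1: F t)%SET.
Proof.
have [p pF] := crashed_at_correct F.
by exists ((Pi^-1)%g p) => t; rewrite inE permKV.
Qed.

Definition perm_pattern n (Pi : {perm 'I_n}) (F : failure_pattern n) :
    failure_pattern n :=
  @FailurePattern n (fun t => Pi @^-1: F t)%SET
    (perm_pattern_mono Pi F) (perm_pattern_correct Pi F).

Definition perm_history n V (Pi : {perm 'I_n}) (H : history n V) : history n V :=
  fun p t => H (Pi p) t.

Definition failure_detector (n : nat) (V : Type) :=
  failure_pattern n -> set (history n V).

Definition anonymous n V (D : failure_detector n V) :=
  forall (F : failure_pattern n) (H : history n V) (Pi : {perm 'I_n}),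
    D F H -> D (perm_pattern Pi F) (perm_history Pi H).

Record anonymous_detector (n : nat) (V : Type) := AnonymousDetector {
  detector :> failure_detector n V;
  detector_anonymous : anonymous detector }.

Definition N_spec (n : nat) : failure_detector n 'I_n.+1 := fun F => [set H |
  (exists t : nat, forall t' : nat, (t <= t')%N ->
     forall q, (#|crashed F| <= H q t')%N) /\
  (forall t q, q \in correct F -> (H q t <= #|crashed F|)%N)].

Definition Theta_spec (n : nat) : failure_detector n bool := fun F => [set H |
  exists (t : nat) (p : 'I_n), p \in correct F /\
    forall t' : nat, (t < t')%N ->
      H p t' = true /\
      forall q, q \in (correct F :\ p)%SET -> H q t' = false].

Lemma mem_crashed_perm n (Pi : {perm 'I_n}) (F : failure_pattern n) p :
  (p \in crashed (perm_pattern Pi F)) = (Pi p \in crashed F).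
Proof.
by rewrite !inE; apply/asboolP/asboolP => -[t]; rewrite ?inE => pt; exists t;
  rewrite ?inE.
Qed.

Lemma mem_correct_perm n (Pi : {perm 'I_n}) (F : failure_pattern n) p :
  (p \in correct (perm_pattern Pi F)) = (Pi p \in correct F).
Proof. by rewrite finset.in_setC [RHS]finset.in_setC mem_crashed_perm. Qed.

Lemma card_crashed_perm n (Pi : {perm 'I_n}) (F : failure_pattern n) :
  #|crashed (perm_pattern Pi F)| = #|crashed F|.
Proof.
rewrite -(card_preimset (crashed F) (@perm_inj _ Pi)).
by apply: eq_card => p; rewrite mem_crashed_perm !inE.
Qed.

Lemma N_anonymous n : anonymous (@N_spec n).
Proof.
move=> F H Pi [[t comp] acc]; split.
  by exists t => t' tt' q; rewrite card_crashed_perm; exact: comp.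
by move=> t0 q; rewrite mem_correct_perm card_crashed_perm; exact: acc.
Qed.

Lemma Theta_anonymous n : anonymous (@Theta_spec n).
Proof.
move=> F H Pi [t [p [pF lead]]]; exists t, ((Pi^-1)%g p); split.
  by rewrite mem_correct_perm permKV.
move=> t' /lead[Hp Hq]; rewrite /perm_history permKV; split => // q.
rewrite finset.in_setD1 mem_correct_perm => /andP[qp qF]; apply: Hq.
by rewrite finset.in_setD1 qF andbT; apply: contra qp => /eqP <-; rewrite permK.
Qed.

Definition FD_N (n : nat) : anonymous_detector n 'I_n.+1 :=
  AnonymousDetector (@N_anonymous n).

Definition FD_Theta (n : nat) : anonymous_detector n bool :=
  AnonymousDetector (@Theta_anonymous n).

(** All processes run the same code from the same initial state. In one step a
    process receives at most one message on each port, queries its failure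
    detector module, flips a coin, changes state and possibly broadcasts. The
    value of the variable [output_p] is read off the local state. *)

Record algorithm (n : nat) (V V' : Type) := Algorithm {
  state : Type;
  message : Type;
  init : state;
  step : state -> ('I_n -> option message) -> V -> bool -> state * option message;
  output : state -> V' }.

Arguments init {n V V'} a.
Arguments step {n V V'} a.
Arguments output {n V V'} a.

(** [local_state r p t] is the state of [p] just before time [t];
    [takes_step r p t] tells whether [p] takes a step at time [t], and
    [sent r p t] is the message it then broadcasts, if any.
    [delivery r i j t = Some s] means that at time [t] process [i] receives
    from [j] the message that [j] broadcast at time [s]. [port r i t] is the
    unknown permutation hiding the senders from [i] at time [t]. It may change
    with the receiver and with time: a single fixed permutation would act as a
    set of names for the senders shared by all receivers. *)
Record run n V V' (A : algorithm n V V') := Run {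
  local_state : 'I_n -> nat -> state A;
  takes_step : 'I_n -> nat -> bool;
  sent : 'I_n -> nat -> option (message A);
  delivery : 'I_n -> 'I_n -> nat -> option nat;
  port : 'I_n -> nat -> {perm 'I_n} }.

(** [received r i j t] is R_i(j,t), and [anonymous_receive r i t] is the function
    j |-> R_i(Pi(j),t), which is all that the algorithm sees. *)
Definition received n V V' (A : algorithm n V V') (r : run A)
    (i j : 'I_n) (t : nat) : option (message A) :=
  obind (sent r j) (delivery r i j t).

Definition anonymous_receive n V V' (A : algorithm n V V') (r : run A)
    (i : 'I_n) (t : nat) : 'I_n -> option (message A) :=
  fun j => received r i (port r i t j) t.

Definition steps_before n V V' (A : algorithm n V V') (r : run A)
    (p : 'I_n) (t : nat) : nat :=
  count (takes_step r p) (iota 0 t).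

Definition output_history n V V' (A : algorithm n V V') (r : run A) :
    history n V' :=
  fun p t => output A (local_state r p t).

(** Asynchronous schedule: crashed processes take no step, correct ones take
    infinitely many, with no bound on relative speeds. *)
Definition fair_schedule n V V' (A : algorithm n V V') (F : failure_pattern n)
    (r : run A) : Prop :=
  (forall p t, takes_step r p t -> p \notin F t) /\
  (forall p, p \in correct F ->
     forall t : nat, exists t' : nat, (t <= t')%N /\ takes_step r p t').

(** Reliable channels between any two distinct processes: only messages sent
    strictly earlier are received, each at most once, and every message broadcast
    is eventually received by every other correct process. *)
Definition reliable_channels n V V' (A : algorithm n V V')
    (F : failure_pattern n) (r : run A) : Prop :=
  [/\ forall i j (t s : nat), delivery r i j t = Some s ->
        [/\ i != j, takes_step r i t, (s < t)%N & isSome (sent r j s)],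
      forall i j (t t' s : nat), delivery r i j t = Some s ->
        delivery r i j t' = Some s -> t = t' &
      forall i j (s : nat), i \in correct F -> i != j -> isSome (sent r j s) ->
        exists t, delivery r i j t = Some s].

(** The k-th step of [p] uses the coin [coin p k]: coins are indexed by local
    steps and not by time, so that the scheduler cannot choose which of them
    are used. *)
Definition follows_algorithm n V V' (A : algorithm n V V') (H : history n V)
    (coin : 'I_n -> nat -> bool) (r : run A) : Prop :=
  (forall p, local_state r p 0 = init A) /\
  (forall p t,
     if takes_step r p t then
       (local_state r p t.+1, sent r p t) =
         step A (local_state r p t) (anonymous_receive r p t) (H p t)
           (coin p (steps_before r p t))
     else local_state r p t.+1 = local_state r p t /\ sent r p t = None).

Definition is_run n V V' (A : algorithm n V V') (F : failure_pattern n)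
    (H : history n V) (coin : 'I_n -> nat -> bool) (r : run A) : Prop :=
  [/\ fair_schedule F r, reliable_channels F r & follows_algorithm H coin r].

(** Independent fair coins: any [m] distinct coins take any prescribed values
    with probability [2^-m]. *)
Definition fair_coins (R : realType) d (T : measurableType d)
    (P : probability T R) (n : nat) (coin : 'I_n -> nat -> T -> bool) : Prop :=
  (forall p k, measurable [set w | coin p k w]) /\
  (forall (s : seq ('I_n * nat)) (b : 'I_n * nat -> bool), uniq s ->
     P [set w | forall i, i \in s -> coin i.1 i.2 w = b i]
       = ((2^-1 ^+ size s : R)%R)%:E).

(** The run [r w] (steps, message delays, ports) is chosen by an adversary that
    may depend arbitrarily, hence possibly non-measurably, on the outcome [w] of
    all the coins; "with probability at least 2/3" therefore means that the event
    contains a measurable event of probability at least 2/3. *)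
Definition randomly_transforms (R : realType) n V V' (E : environment n)
    (D : failure_detector n V) (D' : anonymous_detector n V')
    (A : algorithm n V V') : Prop :=
  forall (d : measure_display) (T : measurableType d) (P : probability T R)
    (coin : 'I_n -> nat -> T -> bool), fair_coins P coin ->
  forall (F : failure_pattern n) (H : history n V) (Pi : {perm 'I_n}),
    E F -> D F H ->
  forall r : T -> run A,
    (forall w, is_run F H (fun p k => coin p k w) (r w)) ->
  exists B : set T, [/\ measurable B,
    B `<=` [set w | detector D' (perm_pattern Pi F)
                       (perm_history Pi (output_history (r w)))] &
    ((2 / 3 : R)%R%:E <= P B)%E].

Definition stronger_randomized (R : realType) n V V' (E : environment n)
    (D : failure_detector n V) (D' : anonymous_detector n V') : Prop :=
  exists A : algorithm n V V', randomly_transforms R E D D' A.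

(* Main.v *)
Require Import Defs.
From mathcomp Require Import all_boot all_algebra all_reals.
From mathcomp Require Import all_order all_fingroup all_classical all_analysis.
From mathcomp Require Import zify ring lra.

(** Every process draws an identity of L random bits and then broadcasts it at
    each of its steps. With L = 2n + 2, a union bound over pairs of processes and
    values makes all identities distinct with probability at least 2/3. A process
    records for each identity the last local step at which it heard it. The
    identities of crashed processes stop being heard, while those of correct
    processes are heard forever. Hence, once N has converged, the n - N most
    recently heard identities are exactly those of the correct processes, and the
    leader is the process with the least identity among them. *)

Set Implicit Arguments.
Unset Strict Implicit.
Unset Printing Implicit Defensive.

Import Order.TTheory GRing.Theory Num.Theory.

Local Open Scope classical_set_scope.

(** * The election algorithm *)

Record elect_state (L : nat) := ElectState {
  steps_done : nat;
  ident : {ffun 'I_L -> bool};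
  heard : {ffun 'I_L -> bool} -> nat;
  alive : nat }.

Definition elect_init L : elect_state L :=
  ElectState 0 [ffun=> false] (fun=> 0) 0.

(** A process hears itself at each step. Its identity is incomplete during the
    first [L] steps; afterwards the stamps of such fragments are no longer renewed. *)
Definition elect_step L n (s : elect_state L)
    (m : 'I_n -> option {ffun 'I_L -> bool}) (h : 'I_n.+1) (b : bool) :
    elect_state L * option {ffun 'I_L -> bool} :=
  (ElectState (steps_done s).+1
     [ffun i : 'I_L => if i == steps_done s :> nat then b else ident s i]
     (fun x => if (x == ident s) || [exists j, m j == Some x]
               then (steps_done s).+1 else heard s x)
     (n - h),
   if L <= steps_done s then Some (ident s) else None).

(** [x] is among the [alive s] most recently heard identities iff fewer than
    [alive s] identities were heard strictly later. *)
Definition elected L (s : elect_state L) : bool :=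
  [forall x, (enum_rank x < enum_rank (ident s)) ==>
    (alive s <= #|[set y | heard s x < heard s y]%SET|)].

Definition election n L : algorithm n 'I_n.+1 bool :=
  Algorithm (elect_init L) (@elect_step L n) (@elected L).

(** The completed identity of [p]. It depends on the coins alone, so the adversary choosing the run
    has no influence on collisions. *)
Definition coin_ident n L (coin : 'I_n -> nat -> bool) (p : 'I_n) :
    {ffun 'I_L -> bool} := [ffun k : 'I_L => coin p k].

(** * Local invariants of a run *)

Section Run.
Variables (n L : nat) (F : failure_pattern n) (H : history n 'I_n.+1).
Variables (coin : 'I_n -> nat -> bool) (r : run (election n L)).
Hypothesis runP : is_run F H coin r.

Local Notation st p t := (local_state r p t : elect_state L).
Local Notation ID := (coin_ident L coin).

Lemma run_init p : st p 0 = elect_init L.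
Proof. by case: runP => _ _ [+ _] => /(_ p). Qed.

Lemma run_stepT p t : takes_step r p t ->
  (st p t.+1, sent r p t) =
  elect_step (st p t) (anonymous_receive r p t) (H p t)
    (coin p (steps_before r p t)).
Proof. by move=> pt; case: runP => _ _ [_ /(_ p t)]; rewrite pt. Qed.

Lemma run_stepF p t : ~~ takes_step r p t ->
  st p t.+1 = st p t /\ sent r p t = None.
Proof. by move=> /negPf pt; case: runP => _ _ [_ /(_ p t)]; rewrite pt. Qed.

(** Links the counter of the algorithm to the index of the coins: step [k] writes [coin p k] at
    position [k]. *)
Lemma steps_doneE p t : steps_done (st p t) = steps_before r p t.
Proof.
elim: t => [|t IH]; first by rewrite run_init.
rewrite /steps_before -[X in iota _ X]addn1 iotaD count_cat /= add0n addn0.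
rewrite -/(steps_before r p t) -IH.
have [pt|pt] := boolP (takes_step r p t).
  by case: (run_stepT pt) => -> _ /=; rewrite addn1.
by have [-> _] := run_stepF pt; rewrite addn0.
Qed.

Lemma identE p t i : ident (st p t) i = (i < steps_done (st p t)) && coin p i.
Proof.
elim: t => [|t IH]; first by rewrite run_init ffunE.
have [pt|pt] := boolP (takes_step r p t); last by have [-> _] := run_stepF pt.
case: (run_stepT pt) => -> _ /=; rewrite ffunE IH -steps_doneE.
by rewrite ltnS [in RHS]leq_eqVlt; case: eqP => [->|].
Qed.

Lemma ident_coin p t : L <= steps_done (st p t) -> ident (st p t) = ID p.
Proof. by move=> Lk; apply/ffunP => i; rewrite identE ffunE (leq_trans _ Lk). Qed.

Lemma steps_doneS p t :
  steps_done (st p t.+1) = takes_step r p t + steps_done (st p t).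
Proof.
have [pt|pt] := boolP (takes_step r p t); last by have [-> _] := run_stepF pt.
by case: (run_stepT pt) => -> _.
Qed.

Lemma steps_done_mono p : {homo (fun t => steps_done (st p t)) : s t / s <= t}.
Proof.
apply: homo_leq => // [y x z|t]; first exact: leq_trans.
by rewrite steps_doneS leq_addl.
Qed.

Lemma heard_le p t x : heard (st p t) x <= steps_done (st p t).
Proof.
elim: t => [|t IH]; first by rewrite run_init.
have [pt|pt] := boolP (takes_step r p t); last by have [-> _] := run_stepF pt.
by case: (run_stepT pt) => -> _ /=; case: ifP => // _; exact: leqW.
Qed.

Lemma heard_mono p x : {homo (fun t => heard (st p t) x) : s t / s <= t}.
Proof.
apply: homo_leq => // [y z w|t]; first exact: leq_trans.
have [pt|pt] := boolP (takes_step r p t); last by have [-> _] := run_stepF pt.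
by case: (run_stepT pt) => -> _ /=; case: ifP => // _; exact/leqW/heard_le.
Qed.

(** The guard on [steps_done] keeps incomplete identities off the channels. *)
Lemma sentE p t : sent r p t =
  if takes_step r p t && (L <= steps_done (st p t)) then Some (ID p) else None.
Proof.
have [pt|pt] := boolP (takes_step r p t); last by have [_ ->] := run_stepF pt.
case: (run_stepT pt) => _ -> /=; case: ifP => // Lk.
by rewrite ident_coin.
Qed.

(** * What is heard in the long run *)

Lemma near_steps_done p m : p \in correct F ->
  \forall t \near \oo, m <= steps_done (st p t).
Proof.
move=> pF; suff [t mt] : exists t, m <= steps_done (st p t).
  by exists t => // t' /= tt'; exact: leq_trans mt (steps_done_mono p tt').
elim: m => [|m [t mt]]; first by exists 0.
have [[_ /(_ p pF t)[t' [tt' pt']]] _ _] := runP.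
exists t'.+1; rewrite steps_doneS pt' ltnS.
exact: leq_trans mt (steps_done_mono p tt').
Qed.

Lemma near_takes_step p (P : nat -> Prop) : p \in correct F ->
  (\forall t \near \oo, P t) -> exists t, P t /\ takes_step r p t.
Proof.
move=> pF [T _ TP].
have [[_ /(_ p pF T)[t [Tt pt]]] _ _] := runP.
by exists t; split => //; exact: TP.
Qed.

(** Stamps count steps of the receiver [i], so it suffices that [j] broadcasts once [i] has made [m]
    steps: the message arrives later still. *)
Lemma near_heard_correct i j m : i \in correct F -> j \in correct F ->
  \forall t \near \oo, m < heard (st i t) (ID j).
Proof.
move=> iF jF; suff [t mt] : exists t, m < heard (st i t) (ID j).
  by exists t => // t' /= tt'; exact: leq_trans mt (heard_mono i (ID j) tt').
(* Channels join distinct processes only; a process renews the stamp of its own identity by its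
   steps. *)
have [->|ij] := eqVneq j i.
  have [t [[mt Lt] it]] := near_takes_step iF
    (filterI (near_steps_done m iF) (near_steps_done L iF)).
  exists t.+1; case: (run_stepT it) => -> _ /=.
  by rewrite ident_coin// eqxx.
have [s [[ms Ls] js]] := near_takes_step jF
  (filterI (near_steps_done m iF) (near_steps_done L jF)).
have sj : sent r j s = Some (ID j) by rewrite sentE js Ls.
have [_ [recv _ deliv] _] := runP.
have [||t sd] := deliv i j s iF; [by rewrite eq_sym | by rewrite sj |].
have [_ it st _] := recv _ _ _ _ sd.
exists t.+1; case: (run_stepT it) => -> _ /=.
suff -> : [exists k, anonymous_receive r i t k == Some (ID j)].
  by rewrite orbT ltnS (leq_trans ms)// steps_done_mono// ltnW.
(* The algorithm accepts an identity on any port, so the hidden permutation does no harm. *)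
apply/existsP; exists ((port r i t)^-1 j)%g.
by rewrite /anonymous_receive permKV /received sd /= sj.
Qed.

(** A crashed process has only finitely many sending times, and each message is delivered at most
    once. *)
Lemma near_crashed_quiet i j : j \notin correct F ->
  \forall t \near \oo, received r i j t = None.
Proof.
have [[noF _] [recv inj _] _] := runP.
rewrite finset.in_setC negbK inE => /asboolP[T jT].
have late s t : delivery r i j t = Some s -> s < T.
  move=> /recv[_ _ _]; rewrite sentE; case: ifP => // /andP[js _] _.
  rewrite ltnNge; apply/negP => Ts.
  by have := noF j s js; rewrite (fintype.subsetP (crashed_at_mono F Ts)).
have : \forall t \near \oo, forall s : 'I_T, delivery r i j t <> Some (val s).
  apply: filter_forall => s.
  have [[t ts]|nots] := pselect (exists t, delivery r i j t = Some (val s)).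
    exists t.+1 => // t' /= tt' t's.
    by rewrite (inj _ _ _ _ _ ts t's) ltnn in tt'.
  by near=> t => ts; apply: nots; exists t.
apply: filterS => t nots; rewrite /received.
case E : (delivery r i j t) => [s|] //.
by have := nots (Ordinal (late _ _ E)); rewrite E.
Unshelve. all: end_near. Qed.

(** From some time [T] on, no message carries [x] and the identity of [i] is complete, hence
    different from [x]. The stamp of [x] thus stays below the step count of [i] at [T]. *)
Lemma near_heard_crashed i x : i \in correct F ->
  (forall j, j \in correct F -> x != ID j) ->
  exists M, forall t, heard (st i t) x <= M.
Proof.
move=> iF xF.
have quiet : \forall t \near \oo, forall j, received r i j t <> Some x.
  apply: filter_forall => j; have [jF|jF] := boolP (j \in correct F).
    near=> t; rewrite /received; case: (delivery r i j t) => //= s.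
    rewrite sentE; case: ifP => // _ [xE].
    by have := xF j jF; rewrite xE eqxx.
  by apply: filterS (near_crashed_quiet i jF) => t ->.
have [T _ TP] := filterI quiet (near_steps_done L iF).
exists (steps_done (st i T)) => t.
have [tT|/ltnW Tt] := leqP t T.
  by rewrite (leq_trans (heard_le _ _ _))// steps_done_mono.
rewrite -(subnK Tt); elim: (t - T) => [|k IH]; first exact: heard_le.
rewrite addSn; set u := k + T in IH *.
have [qu Lu] : (forall j, received r i j u <> Some x) /\ L <= steps_done (st i u).
  by apply: TP; rewrite /= leq_addl.
have [iu|iu] := boolP (takes_step r i u); last by have [-> _] := run_stepF iu.
case: (run_stepT iu) => -> _ /=.
rewrite ident_coin// (negPf (xF i iF)) /=.
by case: ifP => // /existsP[j /eqP]; move/qu.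
Unshelve. all: end_near. Qed.

(** * Convergence of the election *)

Hypothesis NH : N_spec F H.
Hypothesis ID_inj : injective ID.

Local Notation K := [set ID p | p in correct F]%SET.

Lemma near_alive i : i \in correct F ->
  \forall t \near \oo, alive (st i t) = #|K|.
Proof.
move=> iF; have [[T comp] acc] := NH.
have HE t : T <= t -> n - H i t = #|K|.
  move=> Tt; have -> : (H i t : nat) = #|crashed F|.
    by apply/eqP; rewrite eqn_leq acc// comp.
  by rewrite card_imset// [RHS]cardsCs card_ord finset.setCK.
(* [alive] is refreshed only by steps, so it is right after the first step made once [H] has
   converged. *)
have [[_ /(_ i iF T)[t0 [Tt0 it0]]] _ _] := runP.
exists t0.+1 => // t /= t0t; rewrite -(subnK t0t).
elim: (t - t0.+1) => [|k IH].
  by rewrite add0n; case: (run_stepT it0) => -> _ /=; exact: HE.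
rewrite addSn; set u := k + t0.+1 in IH *.
have [iu|iu] := boolP (takes_step r i u); last by have [-> _] := run_stepF iu.
by case: (run_stepT iu) => -> _ /=; apply: HE; rewrite /u; lia.
Qed.

(** There are finitely many values, so one [M] bounds all stamps outside [K], while those in [K]
    outgrow it. For [x] in [K], only other members of [K] can be heard later, fewer than [#|K|]; for
    [x] outside, all of [K] is heard later. *)
Lemma near_elected i : i \in correct F -> \forall t \near \oo,
  elected (st i t) = [forall x in K, enum_rank (ID i) <= enum_rank x].
Proof.
move=> iF.
have [M MP] : exists M, forall t x, x \notin K -> heard (st i t) x <= M.
  have /choice[M MP] x : exists M, x \notin K -> forall t, heard (st i t) x <= M.
    have [xK|xK] := boolP (x \in K); first by exists 0.
    have [|M MP] := near_heard_crashed (x := x) iF; last by exists M.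
    by move=> j jF; apply: contra xK => /eqP ->; exact: imset_f.
  by exists (\max_x M x) => t x xK; rewrite (leq_trans (MP x xK t))// leq_bigmax.
have KP : \forall t \near \oo, forall j, j \in correct F -> M < heard (st i t) (ID j).
  apply: filter_forall => j; have [jF|jF] := boolP (j \in correct F).
    by apply: filterS (near_heard_correct M iF jF).
  by near=> t.
apply: filterS3 KP (near_alive iF) (near_steps_done L iF) => t tK ta tL.
rewrite /elected ta (ident_coin tL).
apply/eq_forallb => x; have [xK|xK] /= := boolP (x \in K).
  rewrite [RHS]leqNgt; case: (_ < _) => //=; apply/negbTE; rewrite -ltnNge.
  apply/proper_card/properP; split; last by exists x; rewrite ?inE ?ltnn.
  apply/fintype.subsetP => y; rewrite inE => xy; apply: contraLR xy => yK.
  have /imsetP[j jF xE] := xK.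
  by rewrite -leqNgt (leq_trans (MP t y yK))// xE ltnW// tK.
apply/implyP => _; apply/subset_leq_card/fintype.subsetP => y /imsetP[j jF ->].
by rewrite inE (leq_ltn_trans (MP t x xK))// tK.
Unshelve. all: end_near. Qed.

Lemma election_Theta : Theta_spec F (output_history r).
Proof.
have [p0 p0F] : exists p, p \in correct F.
  have [p pF] := crashed_at_correct F; exists p.
  rewrite finset.in_setC inE; apply/asboolP => -[t]; exact/negP/pF.
have [p pF pmin] := arg_minnP (fun p => enum_rank (ID p) : nat) p0F.
have : \forall t \near \oo, forall i, i \in correct F ->
    elected (st i t) = [forall x in K, enum_rank (ID i) <= enum_rank x].
  apply: filter_forall => i; have [iF|iF] := boolP (i \in correct F).
    by apply: filterS (near_elected iF).
  by near=> t.
move=> [T _ TP]; exists T, p; split => // t /ltnW Tt; split.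
  rewrite /output_history /= (TP t Tt)//.
  by apply/forall_inP => _ /imsetP[q qF ->]; exact: pmin.
move=> q; rewrite finset.in_setD1 => /andP[qp qF].
rewrite /output_history /= (TP t Tt)//; apply/negbTE/negP.
move=> /forall_inP/(_ (ID p)); rewrite imset_f// => /(_ isT) le_qp.
have := pmin q qF => le_pq.
(* Distinct identities exclude a tie between two leaders. *)
suff /enum_rank_inj/ID_inj pq : enum_rank (ID q) = enum_rank (ID p).
  by rewrite pq eqxx in qp.
by apply/val_inj/eqP; rewrite eqn_leq le_qp.
Unshelve. all: end_near. Qed.

End Run.

(** * Probability of a collision of identities *)

Lemma measure_bigsetU_le d (T : measurableType d) (R : realType)
    (mu : {measure set T -> \bar R}%R) (I : Type) (s : seq I) (Q : pred I)
    (A : I -> set T) : (forall i, measurable (A i)) ->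
  (mu (\big[setU/set0]_(i <- s | Q i) A i) <= \sum_(i <- s | Q i) mu (A i))%E.
Proof.
move=> mA; elim: s => [|i s IH]; first by rewrite !big_nil measure0.
rewrite !big_cons; case: ifP => // _.
apply: le_trans (leeD2l _ IH); apply: measureU2 => //.
exact: bigsetU_measurable.
Qed.

Lemma measurable_coins d (T : measurableType d) (I : choiceType)
    (coin : I -> T -> bool) (s : seq I) (b : I -> bool) :
  (forall i, measurable [set w | coin i w]) ->
  measurable [set w | forall i, i \in s -> coin i w = b i].
Proof.
move=> mcoin; have -> : [set w | forall i, i \in s -> coin i w = b i] =
    \big[setI/setT]_(i <- s) [set w | coin i w = b i].
  by rewrite -bigcap_seq; apply/seteqP; split => w /= + i => /(_ i).
apply: bigsetI_measurable => i _; case: (b i); first exact: mcoin.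
rewrite (_ : [set w | _] = ~` [set w | coin i w]); first exact: measurableC.
by apply/seteqP; split => w /=; [move=> ->|move=> /negP/negbTE].
Qed.

Section Collision.
Variables (R : realType) (d : measure_display) (T : measurableType d).
Variables (P : probability T R) (n L : nat) (coin : 'I_n -> nat -> T -> bool).
Hypothesis coinP : fair_coins P coin.

Local Notation ID w p := (coin_ident L (fun q k => coin q k w) p).

(** Fixing the common value [c.2] turns a collision into prescribed values of coins, the form that
    [fair_coins] handles. *)
Definition same_ident (c : 'I_n * 'I_n * {ffun 'I_L -> bool}) : set T :=
  [set w | ID w c.1.1 = c.2 /\ ID w c.1.2 = c.2].

Lemma same_ident_coins p q v : same_ident (p, q, v) =
  [set w | forall i, i \in [seq (x, val k) | x <- [:: p; q], k <- enum 'I_L] ->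
     (* The default [false] is never reached, since all listed indices are below [L]. *)
     coin i.1 i.2 w = oapp v false (insub i.2)].
Proof.
set s := [seq _ | x <- _, k <- _].
have mem_s x (k : 'I_L) : x \in [:: p; q] -> (x, val k) \in s.
  by move=> xpq; apply/allpairsP; exists (x, k); rewrite mem_enum.
apply/seteqP; split => w.
  move=> [pv qv] c /allpairsP[[x k] [/= + _ ->]]; rewrite valK /=.
  by rewrite !inE => /orP[]/eqP ->; [rewrite -[v]pv|rewrite -[v]qv]; rewrite ffunE.
move=> cv; split; apply/ffunP => k; rewrite ffunE.
  by rewrite (cv _ (mem_s p k _)) ?inE ?eqxx//= valK.
by rewrite (cv _ (mem_s q k _)) ?inE ?eqxx ?orbT//= valK.
Qed.

Lemma measurable_same_ident c : measurable (same_ident c).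
Proof.
case: c => [[p q] v]; rewrite same_ident_coins.
apply: (measurable_coins (coin := fun i => coin i.1 i.2)) => i.
by case: coinP.
Qed.

Lemma prob_same_ident c : c.1.1 != c.1.2 ->
  P (same_ident c) = (2^-1 ^+ (L + L) : R)%R%:E.
Proof.
case: c => [[p q] v] /= pq; rewrite same_ident_coins; case: coinP => _ ->.
  by rewrite size_allpairs size_enum_ord /= mul2n addnn.
(* As [p] and [q] differ, the [L + L] coins involved are distinct. *)
apply: allpairs_uniq; rewrite ?enum_uniq//= ?inE ?pq//.
by move=> [x k] [y l] _ _ /= [-> /val_inj ->].
Qed.

Definition collision : set T :=
  \big[setU/set0]_(c | c.1.1 != c.1.2) same_ident c.

Lemma measurable_collision : measurable collision.
Proof. by apply: bigsetU_measurable => c _; exact: measurable_same_ident. Qed.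

Lemma notin_collision w :
  ~ collision w -> injective (coin_ident L (fun q k => coin q k w)).
Proof.
rewrite /collision -bigcup_pred => ncol p q pq; apply/eqP/negPn/negP => npq.
by apply: ncol; exists (p, q, ID w q).
Qed.

Lemma prob_collision_le : (P collision <= ((n ^ 2)%:R / (2 ^ L)%:R : R)%R%:E)%E.
Proof.
apply: (le_trans (measure_bigsetU_le P _ _ measurable_same_ident)).
rewrite (eq_bigr _ prob_same_ident).
rewrite sumEFin lee_fin.
(* There are [n ^ 2] pairs and [2 ^ L] values, each of weight [2^-1 ^+ (L + L)]; diagonal pairs are
   included, which only enlarges the sum. *)
have -> : ((n ^ 2)%:R / (2 ^ L)%:R =
    \sum_(c : 'I_n * 'I_n * {ffun 'I_L -> bool}) 2^-1 ^+ (L + L) :> R)%R.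
  rewrite sumr_const !card_prod card_ffun card_bool !card_ord.
  have two_pow : (2^-1 ^+ L * (2 ^ L)%:R = 1 :> R)%R.
    by rewrite natrX -exprMn mulVf// expr1n.
  have -> : ((2 ^ L)%:R^-1 = 2^-1 ^+ L :> R)%R by rewrite natrX exprVn.
  rewrite exprD -[RHS]mulr_natr natrX [in RHS]natrM [(n * n)%:R%R]natrM.
  by ring: two_pow.
rewrite [leLHS]big_mkcond; apply: ler_sum => c _.
by case: ifP => // _; rewrite exprn_ge0// invr_ge0.
Qed.

End Collision.

(** * Choice of the identity length and conclusion *)

Theorem theorem4p4 (R : realType) (n : nat) (E : environment n) :
  stronger_randomized R E (FD_N n) (FD_Theta n).
Proof.
pose L := n.*2.+2.
exists (election n L) => d T P coin coinP F H Pi _ NH r runP.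
(* This event is measurable even if [r] is not, and on it every admissible run elects correctly. *)
exists (~` collision L coin); split.
- exact/measurableC/(measurable_collision L coinP).
- move=> w /notin_collision inj; apply: detector_anonymous.
  exact: election_Theta (runP w) NH inj.
- rewrite probability_setC; last exact: (measurable_collision L coinP).
  have := prob_collision_le L coinP.
  have : ((n ^ 2)%:R / (2 ^ L)%:R <= 1 / 3 :> R)%R.
    rewrite ler_pdivrMr ?ltr0n ?expn_gt0// mul1r mulrC ler_pdivlMr//.
    rewrite -natrM ler_nat.
    (* Squaring [n <= 2 ^ n] gives [n ^ 2 <= 2 ^ (n * 2)]; the two extra bits supply a factor 4,
       enough for the required 3. *)
    have := ltnW (ltn_expl n (ltnSn 1)); rewrite -leq_sqr -expnM => n2.
    by rewrite /L !expnS -muln2; lia.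
  move=> le_third le_col; apply: le_trans (leeB (lexx 1%E) le_col).
  by rewrite -EFinB lee_fin; lra.
Qed.
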